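(* Let $B$ and $C$ be commutative rings, let $A$ be a ring that is a free right $B$-module of rank $m$, let $B$ be a free right $C$-module of rank $n$, and let $r\ge1$. Then $$\mathrm{Sdet}_{\mathrm{M}(r,A)}^{C}=\mathrm{Sdet}_{\mathrm{M}(1,B)}^{C}\circ\mathrm{Sdet}_{\mathrm{M}(r,A)}^{B},$$ where $B$ is regarded as $\mathrm{M}(1,B)$.
   Context: Rings have a multiplicative unit; $\mathrm{M}(k,R)$ is the ring of $k\times k$ matrices over $R$. ''$A$ is a free right $B$-module of rank $m$'' means that $B$ is a subring of $A$ and $A=\bigoplus_{i=1}^m e_iB$ for some ordered basis $e=(e_1,\dots,e_m)$ (similarly for $B$ over $C$; then $A$ is a free right $C$-module of rank $mn$). For such rings the left regular representation $L_e:A\to \mathrm{M}(m,B)$, $a\mapsto(b_{ij})$, is defined by $ae_j=\sum_ie_ib_{ij}$. Also $\mathrm{M}(r,A)=\bigoplus_{i=1}^m(e_iI_r)\mathrm{M}(r,B)$ is a free right $\mathrm{M}(r,B)$-module of rank $m$; let $L:\mathrm{M}(r,A)\to \mathrm{M}(m,\mathrm{M}(r,B))$ be a left regular representation (e.g. with respect to $(e_1I_r,\dots,e_mI_r)$). The Study-type determinant is $\mathrm{Sdet}_{\mathrm{M}(r,A)}^B:=\det\circ\,\iota\circ L:\mathrm{M}(r,A)\to B$, where $\iota:\mathrm{M}(m,\mathrm{M}(r,B))\hookrightarrow \mathrm{M}(mr,B)$ is the inclusion (block matrices viewed as $mr\times mr$ matrices) and $\det:\mathrm{M}(mr,B)\to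 B$ is the determinant; it does not depend on the choice of basis. $\mathrm{Sdet}_{\mathrm{M}(r,A)}^C$ and $\mathrm{Sdet}_{\mathrm{M}(1,B)}^C$ are defined in the same way for the pairs $(A,C)$ and $(B,C)$. *)

(* Defs.v *)
From mathcomp Require Import all_boot all_algebra.
From mathcomp Require Import boolp classical_sets.

Set Implicit Arguments.
Unset Strict Implicit.
Unset Printing Implicit Defensive.

Import GRing.Theory.
Local Open Scope ring_scope.

(* "B is a subring of A" is rendered by an injective morphism
   f : {rmorphism B -> A}; the right action of b : B on a : A is a * f b.
   The rings are unital and may be trivial (pzRingType, comPzRingType). *)

Definition right_basis (A B : pzRingType) (f : {rmorphism B -> A}) (m : nat)
    (e : 'I_m -> A) : Prop :=
  forall a : A, exists! b : {ffun 'I_m -> B}, a = \sum_(i < m) e i * f (b i).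

Definition free_right_module (A B : pzRingType) (f : {rmorphism B -> A})
    (m : nat) : Prop :=
  injective f /\ exists e : 'I_m -> A, right_basis f e.

(* L_e; the default value 0 of xget is only used when e is not a basis,
   see left_regularP. *)
Definition left_regular (A B : pzRingType) (f : {rmorphism B -> A}) (m : nat)
    (e : 'I_m -> A) (a : A) : 'M[B]_m :=
  xget 0 [set b : 'M[B]_m |
    forall j : 'I_m, a * e j = \sum_(i < m) e i * f (b i j)].

Lemma left_regularP (A B : pzRingType) (f : {rmorphism B -> A}) (m : nat)
    (e : 'I_m -> A) : right_basis f e ->
  forall (a : A) (b : 'M[B]_m),
    (forall j, a * e j = \sum_(i < m) e i * f (b i j)) <->
    b = left_regular f e a.
Proof.
move=> he a b.
have hL j : a * e j = \sum_(i < m) e i * f (left_regular f e a i j).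
  have /choice [c hc] : forall j, exists c : {ffun 'I_m -> B},
      a * e j = \sum_(i < m) e i * f (c i).
    by move=> k; have [c [hc _]] := he (a * e k); exists c.
  rewrite /left_regular.
  set P := (X in xget _ X).
  suff : P (xget 0 P) by exact.
  apply: xgetPex; exists (\matrix_(i, k) c k i) => k /=.
  by rewrite hc; apply: eq_bigr => i _; rewrite mxE.
split=> [hb|-> //]; apply/matrixP => i j.
have [c [_ hc]] := he (a * e j).
have h1 : c = [ffun i => b i j].
  by apply: hc; rewrite hb; apply: eq_bigr => k _; rewrite ffunE.
have h2 : c = [ffun i => left_regular f e a i j].
  by apply: hc; rewrite hL; apply: eq_bigr => k _; rewrite ffunE.
by have := congr1 (fun g : {ffun 'I_m -> B} => g i) (etrans (esym h1) h2);
   rewrite !ffunE.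
Qed.

(* The inclusion of M(m, M(r, B)) into M(mr, B); the library writes the size of
   a block matrix as the sum of the sizes of its blocks, here m times r. *)
Definition unblock (B : pzRingType) (m r : nat) (M : 'M['M[B]_r]_m) :
    'M[B]_(\sum_(i < m) r) :=
  \mxblock_(i < m, j < m) M i j.

(* The Study-type determinant M(r, A) -> B computed in a basis E of M(r, A) as
   a right module over M(r, B), which acts through the entrywise map_mx f. *)
Definition Sdet (A : pzRingType) (B : comPzRingType) (f : {rmorphism B -> A})
    (r m : nat) (E : 'I_m -> 'M[A]_r) (X : 'M[A]_r) : B :=
  \det (unblock (left_regular (map_mx f : {rmorphism 'M[B]_r -> 'M[A]_r}) E X)).

(* Main.v *)
Require Import Defs.
From HB Require Import structures.
From mathcomp Require Import all_boot all_order all_fingroup all_algebra.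
From mathcomp Require Import boolp.

(* In the product basis E_i g_k, with g a basis of B over C, the matrix of X
   over C is, after reordering the indices, the matrix Y of X over B with each entry
   y replaced by its regular representation rho y in M(n, C).  So the theorem is
   det (rho Y) = det (rho (det Y)) for every ring morphism rho : B -> M(n, C),
   together with the invariance of det under change of basis.

   The determinant identity is proved by induction on the size of Y (Silvester):
   one step of fraction-free elimination with pivot a = Y 0 0 gives it up to a
   power of det (rho a), and this factor is cancelled by working over B[t] and
   C[t] with t + Y in place of Y, where it is a monic polynomial in t; then one
   sets t = 0. *)

Set Implicit Arguments.
Unset Strict Implicit.
Unset Printing Implicit Defensive.

Import GRing.Theory.
Local Open Scope ring_scope.

(** * Determinants of block matrices *)

(** The two matrices differ by one permutation applied to both rows and columns. The sizes [p] and
    [q] are kept apart because those compared later are equal but not convertible. *)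
Lemma det_reindex (R : comPzRingType) (T : finType) p q (h : 'I_p -> T)
    (k : 'I_q -> T) (M : T -> T -> R) : bijective h -> bijective k ->
  \det (\matrix_(i, j) M (h i) (h j)) = \det (\matrix_(i, j) M (k i) (k j)).
Proof.
move=> bij_h bij_k.
have pq : p = q.
  by rewrite -[p]card_ord (bij_eq_card bij_h) -(bij_eq_card bij_k) card_ord.
case: q / pq k bij_k => k [k' kK k'K].
have inj_s : injective (k' \o h) by apply/bij_inj/bij_comp => //; exists k.
pose s := perm inj_s.
have -> : (\matrix_(i, j) M (h i) (h j)) =
    row_perm s (col_perm s (\matrix_(i, j) M (k i) (k j))).
  by apply/matrixP=> i j; rewrite !mxE !permE /= !k'K.
rewrite row_permE col_permE !det_mulmx mulrCA -det_mulmx -perm_mxM.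
by rewrite mulgV perm_mx1 det1 mulr1.
Qed.

Lemma tagnat_sig_pair_bij m r :
  bijective (fun i : 'I_(\sum_(k < m) r) =>
    (tagnat.sig1 i, tagnat.sig2 i) : 'I_m * 'I_r).
Proof.
exists (fun x => tagnat.Rank x.1 x.2) => [i|[i j]] /=; first exact: tagnat.sig2K.
by congr (_, _); [exact: tagnat.Rank1K
                | apply: val_inj; rewrite /= tagnat.Rank2K].
Qed.

Lemma unblock_mul (R : pzRingType) m r (X Y : 'M['M[R]_r]_m) :
  unblock (X *m Y) = unblock X *m unblock Y.
Proof.
by rewrite /unblock mul_mxblock; apply: eq_mxblock => i j; rewrite mxE.
Qed.

Lemma unblock1 (R : pzRingType) m r : unblock (1%:M : 'M['M[R]_r]_m) = 1%:M.
Proof.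
rewrite -[RHS]mxdiagZ /unblock /mxdiag; apply: eq_mxblock => i j.
by rewrite mxE conform_mx_id; case: eqVneq.
Qed.

Section BlockTriangular.
Variables (R : comPzRingType) (r m : nat).

Lemma det_castmx_sq n n' (e : (n = n') * (n = n')) (M : 'M[R]_n) :
  \det (castmx e M) = \det M.
Proof.
by case: e => e1 e2; case: n' / e1 e2 => e2; rewrite castmx_id.
Qed.

(** The block recursion carries a cast between sizes, which the determinant ignores; this brings
    block matrices back to [block_mx]. *)
Lemma det_unblock_recul (X : 'M['M[R]_r]_(1 + m)) :
  \det (unblock X) = \det (block_mx (X 0 0) (\mxrow_j ursubmx X 0 j)
    (\mxcol_i dlsubmx X i 0) (unblock (drsubmx X))).
Proof.
rewrite /unblock mxblock_recul det_castmx_sq.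
congr (\det (block_mx _ _ _ _)).
- by apply: eq_mxrow => j; rewrite !mxE lshift0 rshift1.
- by apply: eq_mxcol => j; rewrite !mxE lshift0 rshift1.
- by apply: eq_mxblock => i j; rewrite !mxE !rshift1.
Qed.

Lemma det_unblock_ublock (a : 'M[R]_r) (u : 'rV['M[R]_r]_m) D :
  \det (unblock (block_mx a%:M u 0 D : 'M_(1 + m))) =
    \det a * \det (unblock D).
Proof.
rewrite det_unblock_recul block_mxKdl block_mxKdr.
have -> : (\mxcol_i (0 : 'M['M[R]_r]_(m, 1)) i 0) = 0.
  by apply/matrixP => i j; rewrite !mxE.
rewrite det_ublock mxE; case: splitP => // j _; rewrite ord1 !mxE.
by case: splitP => // k _; rewrite ord1 mxE.
Qed.

Lemma det_unblock_lblock (a : 'M[R]_r) (u : 'cV['M[R]_r]_m) D :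
  \det (unblock (block_mx a%:M 0 u D : 'M_(1 + m))) =
    \det a * \det (unblock D).
Proof.
rewrite det_unblock_recul block_mxKur block_mxKdr.
have -> : (\mxrow_j (0 : 'M['M[R]_r]_(1, m)) 0 j) = 0.
  by apply/matrixP => i j; rewrite !mxE.
rewrite det_lblock mxE; case: splitP => // j _; rewrite ord1 !mxE.
by case: splitP => // k _; rewrite ord1 mxE.
Qed.

End BlockTriangular.

Lemma det_unblock_scalar (R : comPzRingType) r m (a : 'M[R]_r) :
  \det (unblock (a%:M : 'M_m)) = \det a ^+ m.
Proof.
elim: m => [|m IHm].
  by rewrite [_%:M]flatmx0 -[X in unblock X](flatmx0 1%:M) unblock1 det1.
by rewrite (@scalar_mx_block _ 1 m) det_unblock_ublock IHm exprS.
Qed.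

(** * One elimination step *)

Section Elimination.
Variables (B C : comPzRingType) (n N : nat) (rho : {rmorphism B -> 'M[C]_n}).
Hypothesis IH : forall Y : 'M[B]_N,
  \det (unblock (map_mx rho Y)) = \det (rho (\det Y)).

(* Left multiplication by T clears the first column of Y below the pivot; the
   entries of Y commute, so no inverse of the pivot is needed. *)
Lemma det_unblock_map_pivot (Y : 'M[B]_(1 + N)) : let d := \det (rho (Y 0 0)) in
  d ^+ N * \det (unblock (map_mx rho Y)) = d ^+ N * \det (rho (\det Y)).
Proof.
move=> d; pose a := Y 0 0.
pose T : 'M[B]_(1 + N) := block_mx 1%:M 0 (- dlsubmx Y) a%:M.
pose S := a *: drsubmx Y - dlsubmx Y *m ursubmx Y.
have ulY : ulsubmx Y = a%:M.
  by apply/matrixP => i j; rewrite !ord1 !mxE lshift0 mulr1n.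
have TY : T *m Y = block_mx a%:M (ursubmx Y) 0 S.
  rewrite -[Y in T *m Y]submxK mulmx_block !mul1mx !mul0mx !addr0 ulY.
  rewrite mul_mx_scalar !mul_scalar_mx mulNmx.
  by rewrite scalerN addNr addrC.
(* Here determinants are taken over [B]; the image of this identity under [rho] is what closes the
   proof. *)
have detTY : a ^+ N * \det Y = a * \det S.
  have := congr1 determinant TY; rewrite det_mulmx det_lblock det_ublock.
  by rewrite det1 mul1r det_scalar det_scalar1.
have detT : \det (unblock (map_mx rho T)) = d ^+ N.
  rewrite map_block_mx !map_scalar_mx map_mx0 det_unblock_lblock.
  by rewrite det_unblock_scalar rmorph1 det1 mul1r.
(* The left side is now the determinant of the image of [T *m Y], block triangular with the smaller
   matrix [S], to which [IH] applies. *)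
rewrite -[in LHS]detT -det_mulmx -unblock_mul -map_mxM TY.
rewrite map_block_mx map_scalar_mx map_mx0 det_unblock_ublock IH.
have detM x y : \det (rho (x * y)) = \det (rho x) * \det (rho y).
  by rewrite rmorphM det_mulmx.
have detX x k : \det (rho (x ^+ k)) = \det (rho x) ^+ k.
  by elim: k => [|k IHk]; rewrite ?exprS ?detM ?IHk // rmorph1 det1.
by rewrite -detM -detTY detM detX.
Qed.

End Elimination.

(** * Passage to polynomials *)

Section PolyMorphism.
Variables (B C : nzRingType) (n : nat) (rho : {rmorphism B -> 'M[C]_n}).

(** This is [rho] applied coefficientwise, with polynomials over matrices read as matrices of
    polynomials. Cutting at [size p] loses nothing, as [rho] sends 0 to 0. *)
Definition map_poly_mx (p : {poly B}) : 'M[{poly C}]_n :=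
  \matrix_(i, j) \poly_(k < size p) rho p`_k i j.

Lemma coef_map_poly_mx p i j k : (map_poly_mx p i j)`_k = rho p`_k i j.
Proof.
rewrite mxE coef_poly; case: ltnP => // le_p_k.
by rewrite nth_default // rmorph0 mxE.
Qed.

Fact map_poly_mx_is_zmod_morphism : zmod_morphism map_poly_mx.
Proof.
move=> p q; apply/matrixP => i j; apply/polyP => k.
have mxB (V : zmodType) (P Q : 'M[V]_n) : (P - Q) i j = P i j - Q i j.
  by rewrite !mxE.
by rewrite coef_map_poly_mx coefB rmorphB !mxB coefB !coef_map_poly_mx.
Qed.

Fact map_poly_mx_is_monoid_morphism : monoid_morphism map_poly_mx.
Proof.
split.
  apply/matrixP => i j; apply/polyP => k.
  rewrite coef_map_poly_mx coef1 [in RHS]mxE coefMn coef1.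
  by case: (k == 0%N); rewrite ?rmorph1 ?rmorph0 mxE ?mul0rn.
move=> p q; apply/matrixP => i j; apply/polyP => k.
rewrite coef_map_poly_mx coefM rmorph_sum summxE mxE coef_sum.
under [RHS]eq_bigr => l _ do rewrite coefM.
rewrite exchange_big; apply: eq_bigr => l _ /=.
rewrite rmorphM mxE; apply: eq_bigr => x _.
by rewrite !coef_map_poly_mx.
Qed.

HB.instance Definition _ := GRing.isZmodMorphism.Build _ _ map_poly_mx
  map_poly_mx_is_zmod_morphism.
HB.instance Definition _ := GRing.isMonoidMorphism.Build _ _ map_poly_mx
  map_poly_mx_is_monoid_morphism.

Lemma map_poly_mxC b : map_poly_mx b%:P = map_mx polyC (rho b).
Proof.
apply/matrixP => i j; apply/polyP => k.
rewrite coef_map_poly_mx mxE !coefC; case: eqP => // _.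
by rewrite rmorph0 mxE.
Qed.

Lemma map_poly_mxX : map_poly_mx 'X = 'X%:M.
Proof.
apply/matrixP => i j; apply/polyP => k.
rewrite coef_map_poly_mx coefX [in RHS]mxE coefMn coefX.
by case: (k == 1%N); rewrite ?rmorph1 ?rmorph0 mxE ?mul0rn.
Qed.

End PolyMorphism.

Lemma horner0_map_poly_mx (B C : comNzRingType) n (rho : {rmorphism B -> 'M[C]_n})
    (p : {poly B}) :
  map_mx (horner_eval 0) (map_poly_mx rho p) = rho p.[0].
Proof.
apply/matrixP => i j.
by rewrite mxE /horner_eval !horner_coef0 coef_map_poly_mx.
Qed.

(** * The determinant identity *)

Lemma det_unblock_map_nz (B C : comNzRingType) n (rho : {rmorphism B -> 'M[C]_n})
    N (Y : 'M[B]_N) :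
  \det (unblock (map_mx rho Y)) = \det (rho (\det Y)).
Proof.
(* Rings and morphism are generalized, since the induction hypothesis is used over polynomial
   rings. *)
elim: N => [|N IHN] in B C rho Y *.
  have -> : Y = 1%:M by rewrite [LHS]flatmx0 [RHS]flatmx0.
  by rewrite map_mx1 unblock1 !det1 rmorph1 det1.
pose X : 'M[{poly B}]_(1 + N) := 'X%:M + map_mx polyC Y.
have := det_unblock_map_pivot (IHN _ _ (map_poly_mx rho)) X.
(* The pivot t + Y 0 0 goes to t + [rho (Y 0 0)], whose determinant is a characteristic polynomial,
   hence monic and cancellable, as are its powers. *)
have -> : \det (map_poly_mx rho (X 0 0)) = char_poly (- rho (Y 0 0)).
  rewrite !mxE eqxx mulr1n rmorphD /= map_poly_mxX map_poly_mxC.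
  by rewrite /char_poly /char_poly_mx map_mxN opprK.
move/(lregX (monic_lreg (char_poly_monic _))).
move/(congr1 (horner_eval 0)); rewrite -!(det_map_mx (horner_eval 0)).
rewrite horner0_map_poly_mx.
have X0 : map_mx (horner_eval 0) X = Y.
  apply/matrixP => i j; rewrite !mxE /horner_eval hornerD hornerMn hornerX.
  by rewrite mul0rn add0r hornerC.
rewrite -horner_evalE -det_map_mx X0 => <-; congr (\det _).
rewrite -[in LHS]X0; apply/matrixP => i j.
rewrite 2!mxE [in LHS]mxE [in RHS]mxE [in RHS]mxE [in RHS]mxE.
by rewrite -horner0_map_poly_mx mxE.
Qed.

(* Polynomials need nontrivial coefficients, so the trivial rings, and also
   trivial B with n = 0, are treated apart. *)
Lemma det_unblock_map (B C : comPzRingType) n (rho : {rmorphism B -> 'M[C]_n})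
    N (Y : 'M[B]_N) :
  \det (unblock (map_mx rho Y)) = \det (rho (\det Y)).
Proof.
have triv (R : comPzRingType) (x y : R) : 1 = 0 :> R -> x = y.
  by move=> R0; rewrite -[x]mul1r -[y]mul1r R0 !mul0r.
have [/triv//|nzC] := pselect (1 = 0 :> C).
have [B0|nzB] := pselect (1 = 0 :> B).
  rewrite (triv _ (\det Y) 1 B0) rmorph1 det1.
  have -> : Y = 1%:M by apply/matrixP => i j; apply: triv.
  by rewrite map_mx1 unblock1 det1.
pose B' : comNzRingType := HB.pack (GRing.ComPzRing.sort B) B
  (GRing.PzSemiRing_isNonZero.Build B (introN eqP nzB)).
pose C' : comNzRingType := HB.pack (GRing.ComPzRing.sort C) C
  (GRing.PzSemiRing_isNonZero.Build C (introN eqP nzC)).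
exact: (@det_unblock_map_nz B' C').
Qed.

(** * Regular representations and change of basis *)

Section LeftRegular.
Variables (A B : pzRingType) (f : {rmorphism B -> A}) (m : nat) (e : 'I_m -> A).
Hypothesis he : right_basis f e.

Lemma right_basis_span (k : nat) (a : 'I_k -> A) :
  exists P : 'M[B]_(m, k), forall j, a j = \sum_(i < m) e i * f (P i j).
Proof.
have /choice [c hc] j : exists c : {ffun 'I_m -> B},
    a j = \sum_(i < m) e i * f (c i) by have [c []] := he (a j); exists c.
exists (\matrix_(i, j) c j i) => j.
by rewrite hc; apply: eq_bigr => i _; rewrite mxE.
Qed.

Lemma right_basis_inj (k : nat) (P Q : 'M[B]_(m, k)) :
  (\row_j e j) *m map_mx f P = (\row_j e j) *m map_mx f Q -> P = Q.
Proof.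
move=> /matrixP ePQ; apply/matrixP => i j.
have [c [_ c_uniq]] := he (\sum_(i < m) e i * f (P i j)).
have /c_uniq cP : \sum_(i < m) e i * f (P i j) =
    \sum_(i < m) e i * f ([ffun i => P i j] i).
  by apply: eq_bigr => l _; rewrite ffunE.
have /c_uniq cQ : \sum_(i < m) e i * f (P i j) =
    \sum_(i < m) e i * f ([ffun i => Q i j] i).
  have := ePQ 0 j; rewrite !mxE.
  under eq_bigr => l _ do rewrite !mxE.
  under [RHS]eq_bigr => l _ do rewrite !mxE.
  by move=> ->; apply: eq_bigr => l _; rewrite ffunE.
by have /ffunP/(_ i) := etrans (esym cP) cQ; rewrite !ffunE.
Qed.

Lemma mul_left_regular a j :
  a * e j = \sum_(i < m) e i * f (left_regular f e a i j).
Proof. exact: (left_regularP he a _).2. Qed.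

Lemma left_regular_rmorphism :
  exists rho : {rmorphism A -> 'M[B]_m}, rho =1 left_regular f e.
Proof.
have addL : zmod_morphism (left_regular f e).
  move=> a b; apply/esym/(left_regularP he) => j.
  rewrite mulrBl !mul_left_regular -sumrB; apply: eq_bigr => i _.
  by rewrite !mxE rmorphB mulrBr.
have mulL : monoid_morphism (left_regular f e).
  split.
    apply/esym/(left_regularP he) => j.
    rewrite mul1r (bigD1 j) //= mxE eqxx rmorph1 mulr1 big1 ?addr0 // => i ij.
    by rewrite mxE (negPf ij) rmorph0 mulr0.
  move=> a b; apply/esym/(left_regularP he) => j.
  rewrite -mulrA mul_left_regular mulr_sumr.
  under eq_bigr => i _ do rewrite mulrA mul_left_regular mulr_suml.
  rewrite exchange_big; apply: eq_bigr => i _ /=.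
  rewrite mxE rmorph_sum mulr_sumr; apply: eq_bigr => k _.
  by rewrite rmorphM mulrA.
pose rho : {rmorphism A -> 'M[B]_m} := HB.pack (left_regular f e)
  (GRing.isZmodMorphism.Build _ _ _ addL)
  (GRing.isMonoidMorphism.Build _ _ _ mulL).
by exists rho.
Qed.

(** Expanding [e'] in the basis [e] gives [P], and both equations follow by uniqueness of
    coordinates. Of [e'] it is asked that it express [e] and carry the action of [a], which is what
    is checked later for the product family. *)
Lemma left_regular_change (e' : 'I_m -> A) (Q L : 'M[B]_m) (a : A) :
    (forall j, e j = \sum_(i < m) e' i * f (Q i j)) ->
    (forall j, a * e' j = \sum_(i < m) e' i * f (L i j)) ->
  exists2 P, P *m Q = 1%:M & left_regular f e a = P *m L *m Q.
Proof.
have rowE (x y : 'I_m -> A) (M : 'M[B]_m) :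
    (forall j, x j = \sum_(i < m) y i * f (M i j)) ->
    \row_j x j = (\row_j y j) *m map_mx f M.
  move=> xyM; apply/rowP => j; rewrite !mxE xyM.
  by apply: eq_bigr => i _; rewrite !mxE.
have rowZ (x : 'I_m -> A) : \row_j (a * x j) = a *: \row_j x j.
  by apply/rowP => j; rewrite !mxE.
have [P /rowE eP] := right_basis_span e'.
move=> /rowE eQ /rowE; rewrite rowZ => eL.
exists P; apply: right_basis_inj.
  by rewrite map_mxM mulmxA -eP -eQ map_mx1 mulmx1.
have /rowE <- := mul_left_regular a.
by rewrite rowZ [in LHS]eQ scalemxAl eL eP -!mulmxA -!map_mxM mulmxA.
Qed.

End LeftRegular.

(** Coordinates in M(1, C) and in C correspond through the single entry and scalar matrices. *)
Lemma right_basis_mx11 (B C : pzRingType) (g : {rmorphism C -> B}) n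
    (G : 'I_n -> 'M[B]_1) :
  right_basis (map_mx g : {rmorphism 'M[C]_1 -> 'M[B]_1}) G ->
  right_basis g (fun k => G k 0 0).
Proof.
move=> hG b.
have entry (c : 'I_n -> 'M[C]_1) : (\sum_(k < n) G k * map_mx g (c k)) 0 0 =
    \sum_(k < n) G k 0 0 * g (c k 0 0).
  by rewrite summxE; apply: eq_bigr => k _; rewrite mxE big_ord1 mxE.
have [c [hc c_uniq]] := hG b%:M; exists [ffun k => c k 0 0]; split.
  under eq_bigr => k _ do rewrite ffunE.
  by rewrite -entry -hc mxE.
move=> d hd; apply/ffunP => k; rewrite ffunE.
rewrite (c_uniq [ffun k => (d k)%:M]); first by rewrite ffunE mxE.
apply/matrixP => i j; rewrite !ord1 entry mxE eqxx hd.
by apply: eq_bigr => l _; rewrite ffunE mxE.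
Qed.

(** * Matrices over B in coordinates over C *)

Section ScalarExtension.
Variables (B C : pzRingType) (g : {rmorphism C -> B}) (n r : nat).
Variables (e : 'I_n -> B).
Hypothesis he : right_basis g e.

Lemma sum_scalar_mxE (c : 'I_n -> 'M[C]_r) s t :
  (\sum_(k < n) (e k)%:M *m map_mx g (c k)) s t =
    \sum_(k < n) e k * g (c k s t).
Proof.
by rewrite summxE; apply: eq_bigr => k _; rewrite mul_scalar_mx !mxE.
Qed.

Lemma right_basis_mx_span (b : 'M[B]_r) : exists c : 'I_n -> 'M[C]_r,
  b = \sum_(k < n) (e k)%:M *m map_mx g (c k).
Proof.
have /choice [c hc] (st : 'I_r * 'I_r) : exists c : {ffun 'I_n -> C},
    b st.1 st.2 = \sum_(k < n) e k * g (c k).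
  by have [c []] := he (b st.1 st.2); exists c.
exists (fun k => \matrix_(s, t) c (s, t) k); apply/matrixP => s t.
rewrite sum_scalar_mxE (hc (s, t)).
by apply: eq_bigr => k _; rewrite mxE.
Qed.

(** Entry (s, t) is the expansion of [b s t * e l]. The two block levels get exchanged: n by n
    blocks of size r, where replacing each entry of [b] by its image gives r by r blocks of size
    n. *)
Lemma mul_mx_left_regular (b : 'M[B]_r) l : b *m (e l)%:M =
  \sum_(k < n) (e k)%:M *m map_mx g
    (\matrix_(s, t) left_regular g e (b s t) k l).
Proof.
apply/matrixP => s t; rewrite sum_scalar_mxE.
transitivity (b s t * e l).
  rewrite mxE (bigD1 t) //= mxE eqxx big1 ?addr0 // => k kt.
  by rewrite mxE (negPf kt) mulr0.
rewrite (mul_left_regular he).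
by apply: eq_bigr => k _; rewrite mxE.
Qed.

End ScalarExtension.

(** * Study-type determinants *)

(** The determinants of [P] and [Q] commute with that of [L] and have product 1, so they cancel. *)
Lemma Sdet_change (A : pzRingType) (B : comPzRingType) (f : {rmorphism B -> A})
    (r m : nat) (E E' : 'I_m -> 'M[A]_r) (Q L : 'M['M[B]_r]_m) (X : 'M[A]_r) :
    right_basis (map_mx f : {rmorphism 'M[B]_r -> 'M[A]_r}) E ->
    (forall j, E j = \sum_(i < m) E' i *m map_mx f (Q i j)) ->
    (forall j, X *m E' j = \sum_(i < m) E' i *m map_mx f (L i j)) ->
  Sdet f E X = \det (unblock L).
Proof.
move=> hE hQ hL; have [P PQ1 LPQ] := left_regular_change hE hQ hL.
rewrite /Sdet LPQ !unblock_mul !det_mulmx mulrAC -det_mulmx -unblock_mul PQ1.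
by rewrite unblock1 det1 mul1r.
Qed.

Lemma Sdet_scalar (B C : comPzRingType) (g : {rmorphism C -> B}) n
    (G : 'I_n -> 'M[B]_1) (b : B) :
  right_basis (map_mx g : {rmorphism 'M[C]_1 -> 'M[B]_1}) G ->
  Sdet g G b%:M = \det (left_regular g (fun k => G k 0 0) b).
Proof.
move=> hG; pose L := left_regular g (fun k => G k 0 0) b.
have hL j : b%:M *m G j = \sum_(i < n) G i *m map_mx g (L i j)%:M.
  rewrite [G j]mx11_scalar -scalar_mxM (mul_left_regular (right_basis_mx11 hG)).
  rewrite raddf_sum; apply: eq_bigr => i _ /=.
  by rewrite [G i in RHS]mx11_scalar map_scalar_mx -scalar_mxM.
rewrite /Sdet -(left_regularP hG b%:M (\matrix_(i, j) (L i j)%:M)).1; last first.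
  by move=> j; rewrite [LHS]hL; apply: eq_bigr => i _; rewrite mxE.
(* With blocks of size 1, flattening only renames the indices. *)
have /(det_reindex (fun x y : 'I_n * 'I_1 =>
    (L x.1 y.1)%:M x.2 y.2))/(_ (tagnat_sig_pair_bij n 1)) :
    bijective (fun k : 'I_n => (k, 0 : 'I_1)).
  by exists fst => // -[i j]; rewrite (ord1 j).
move=> /esym; congr (_ = _); congr (\det _); apply/matrixP => i j.
  by rewrite !mxE.
by rewrite !mxE eqxx.
Qed.

Theorem theorem6p4 (A : pzRingType) (B C : comPzRingType)
    (f : {rmorphism B -> A}) (g : {rmorphism C -> B}) (m n r : nat)
    (hA : free_right_module f m) (hB : free_right_module g n)
    (hr : (1 <= r)%N)
    (E : 'I_m -> 'M[A]_r)
    (hE : right_basis (map_mx f : {rmorphism 'M[B]_r -> 'M[A]_r}) E)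
    (F : 'I_(m * n) -> 'M[A]_r)
    (hF : right_basis
            (map_mx (f \o g) : {rmorphism 'M[C]_r -> 'M[A]_r}) F)
    (G : 'I_n -> 'M[B]_1)
    (hG : right_basis (map_mx g : {rmorphism 'M[C]_1 -> 'M[B]_1}) G) :
  Sdet (f \o g : {rmorphism C -> A}) F
    =1 Sdet g G \o (scalar_mx : B -> 'M[B]_1) \o Sdet f E.
Proof.
move=> X /=; rewrite (Sdet_scalar _ hG).
pose e k := G k 0 0; have he : right_basis g e := right_basis_mx11 hG.
have [rho rhoE] := left_regular_rmorphism he.
(* Read backwards, the determinant identity moves [rho] inside the determinant over [B]. *)
rewrite -rhoE /Sdet -det_unblock_map.
pose LE : 'M['M[B]_r]_m := left_regular
  (map_mx f : {rmorphism 'M[B]_r -> 'M[A]_r}) E X.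
have [u bij_u] : exists u : 'I_(m * n) -> 'I_m * 'I_n, bijective u.
  exists (enum_val \o cast_ord (esym (mxvec_cast m n))).
  apply: bij_comp; first exact: enum_val_bij.
  by exists (cast_ord (mxvec_cast m n)); [apply: cast_ordKV | apply: cast_ordK].
pose F' (x : 'I_m * 'I_n) := E x.1 *m map_mx f (e x.2)%:M.
have sumF' (c : 'I_m * 'I_n -> 'M[C]_r) :
    \sum_(i < m * n) F' (u i) *m map_mx (f \o g) (c (u i)) =
    \sum_(i < m) E i *m
      map_mx f (\sum_(k < n) (e k)%:M *m map_mx g (c (i, k))).
  transitivity (\sum_(i < m) \sum_(k < n)
      F' (i, k) *m map_mx (f \o g) (c (i, k))).
    rewrite pair_bigA [RHS](reindex u) /=; last exact: onW_bij.
    by apply: eq_bigr => i _; rewrite -surjective_pairing.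
  apply: eq_bigr => i _; rewrite raddf_sum mulmx_sumr.
  apply: eq_bigr => k _ /=.
  by rewrite map_mxM -map_mx_comp mulmxA.
(* [F j] is expanded in [E] over M(r, B), then each coefficient over M(r, C) in the scalar matrices
   of [e]. *)
have /choice [Q hQ] j : exists c : 'I_m * 'I_n -> 'M[C]_r,
    F j = \sum_(i < m * n) F' (u i) *m map_mx (f \o g) (c (u i)).
  have [b [hb _]] := hE (F j).
  have /choice [c hc] i := right_basis_mx_span he (b i).
  exists (fun x => c x.1 x.2); rewrite [RHS](sumF' (fun x => c x.1 x.2)) hb.
  by apply: eq_bigr => i _; rewrite hc.
pose L : 'M['M[C]_r]_(m * n) := \matrix_(i, j)
  \matrix_(s, t) rho (LE (u i).1 (u j).1 s t) (u i).2 (u j).2.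
(* [F] is exchanged for the product family, in which [X] has the matrix [L]. *)
rewrite -/LE; transitivity (\det (unblock L)).
  apply: (Sdet_change (E' := F' \o u) (Q := \matrix_(i, j) Q j (u i))) hF _ _.
    by move=> j; rewrite hQ; apply: eq_bigr => i _; rewrite mxE.
  move=> j /=.
  under [RHS]eq_bigr => i _ do rewrite mxE.
  rewrite [RHS](sumF' (fun x =>
    \matrix_(s, t) rho (LE x.1 (u j).1 s t) x.2 (u j).2)).
  rewrite mulmxA [X *m _](mul_left_regular hE) mulmx_suml.
  apply: eq_bigr => i _; rewrite -mulmxA -map_mxM; congr (_ *m map_mx f _).
  rewrite (mul_mx_left_regular he); apply: eq_bigr => k _.
  by congr (_ *m map_mx g _); apply/matrixP => s t; rewrite !mxE rhoE.
have pair_bij := tagnat_sig_pair_bij.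
(* Both flattened matrices have the same entries, indexed by triples (i, s, k) with i for [E], s for
   the row within an r by r block and k for [e]; [h] and [h'] read the triple off the two
   nestings. *)
pose h (i : 'I_(\sum_(k < m * n) r)) : 'I_m * 'I_r * 'I_n :=
  ((u (tagnat.sig1 i)).1, tagnat.sig2 i, (u (tagnat.sig1 i)).2).
pose h' (i : 'I_(\sum_(k < \sum_(l < m) r) n)) : 'I_m * 'I_r * 'I_n :=
  (tagnat.sig1 (tagnat.sig1 i), tagnat.sig2 (tagnat.sig1 i), tagnat.sig2 i).
have bij_h : bijective h.
  have [v uK vK] := bij_u; have [w wK Kw] := pair_bij (m * n)%N r.
  exists (fun x => w (v (x.1.1, x.2), x.1.2)) => [i|[[i s] k]].
    by rewrite /h /= -surjective_pairing uK; apply: wK.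
  by rewrite /h; have [-> ->] := Kw (v (i, k), s); rewrite vK.
have bij_h' : bijective h'.
  have [v vK Kv] := pair_bij (\sum_(l < m) r)%N n.
  have [w wK Kw] := pair_bij m r.
  exists (fun x => v (w x.1, x.2)) => [i|[x k]].
    rewrite /h' /= [w _]wK; exact: vK.
  rewrite /h' /=; have [-> ->] := Kv (w x, k).
  by have := Kw x; case: x => i s [-> ->].
have := det_reindex (fun x y => rho (LE x.1.1 y.1.1 x.1.2 y.1.2) x.2 y.2)
  bij_h bij_h'.
congr (_ = _); congr (\det _); apply/matrixP => i j; first by rewrite !mxE.
by rewrite 4!mxE.
Qed.
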